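(* Let $X\subseteq\mathbb{R}^d$ be compact and convex, let $f:X\times\Delta\to\mathbb{R}$ be lower semi-continuous on $X\times\Delta$ and such that $f(\cdot,\delta)$ is convex on $X$ for every $\delta\in\Delta$, and suppose there exists $x\in X$ with $f(x,\delta)\le 0$ for all $\delta\in\Delta$. Let $N\ge d$ be an integer and let $\omega_N=(\delta_1,\dots,\delta_N)$ consist of $N$ i.i.d. samples drawn according to $\mathbb{P}$. For any $\varepsilon\in(0,1)$, with $\alpha^*(\varepsilon):=\sup\{\alpha\ge 0: p_N(\alpha)\le\varepsilon\}$, it holds that $$\mathbb{P}^{N}\{\omega_N\in\Delta^{N}: J^\star\le g_N(\omega_N)+\alpha^*(\varepsilon)\}\ge\varepsilon .$$
   Context: Setting: $d\ge 1$ is an integer, $c\in\mathbb{R}^d$, $X\subseteq\mathbb{R}^d$, and $\Delta\subseteq\mathbb{R}^m$ is nonempty. $(\Delta,\mathcal{B}(\Delta),\mathbb{P})$ is a probability space with $\mathcal{B}(\Delta)$ the Borel $\sigma$-algebra of $\Delta$ and $\mathbb{P}$ having support $\Delta$; $\mathbb{P}^N$ is the product measure on $\Delta^N$. Robust convex program: $J^\star:=\inf\{c^\top x: x\in X,\ f(x,\delta)\le 0\ \forall\delta\in\Delta\}$. Scenario program value: for $\omega=(\delta_1,\dots,\delta_N)\in\Delta^N$, $g_N(\omega):=\min\{c^\top x: x\in X,\ f(x,\delta_i)\le 0,\ i=1,\dots,N\}$. Put $g_N^*:=\sup_{\omega\in\Delta^N}g_N(\omega)$. Tail probability: for $\alpha\ge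 0$, $p_N(\alpha):=\mathbb{P}^N\{\omega\in\Delta^N: g_N^*-\alpha\le g_N(\omega)\}$. Convention: in the definition of $\alpha^*(\varepsilon)$, the supremum is taken in $[0,\infty)$, so that it equals $0$ if the set is empty. *)

(* Defs.v *)
From HB Require Import structures.
From mathcomp Require Import all_boot all_order all_algebra.
From mathcomp Require Import all_classical all_reals all_analysis.

Set Implicit Arguments.
Unset Strict Implicit.
Unset Printing Implicit Defensive.

Import Order.TTheory GRing.Theory Num.Theory.
Import numFieldNormedType.Exports.

Local Open Scope classical_set_scope.
Local Open Scope ring_scope.

(* A nonempty subset A of a topological space as a space of its own, with the
   relative topology and the Borel sigma-algebra of that topology.
   Nonemptiness is a parameter because measurable types are pointed. *)
Section borel_subspace.
Context {T : topologicalType} {A : set T}.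

Definition borel_subspace (A0 : A !=set0) : Type := set_type A.

Variable A0 : A !=set0.

HB.instance Definition _ :=
  Topological.copy (borel_subspace A0) (set_type A).

Let point0 : borel_subspace A0 :=
  exist (fun y => y \in A) (sval (cid A0)) (mem_set (svalP (cid A0))).

HB.instance Definition _ := isPointed.Build (borel_subspace A0) point0.

HB.instance Definition _ := Measurable.copy (borel_subspace A0)
  (g_sigma_algebraType (@open (borel_subspace A0))).

End borel_subspace.

Section product_probability.
Context {d} {T : measurableType d} {R : realType}.

Definition tuple_cons n (z : T * n.-tuple T) : n.+1.-tuple T :=
  [tuple of z.1 :: z.2].

Lemma measurable_tuple_cons n : measurable_fun setT (@tuple_cons n).
Proof. exact: measurable_cons. Qed.

HB.instance Definition _ n :=
  isMeasurableFun.Build _ _ _ _ (@tuple_cons n) (@measurable_tuple_cons n).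

(* The product measure P^n on n-tuples: P^(n+1) is the image of P \x P^n under
   (x, t) |-> x :: t. *)
Fixpoint prod_prob (P : probability T R) n : probability (n.-tuple T) R :=
  match n with
  | 0 => \d_([tuple] : 0.-tuple T)
  | n'.+1 => distribution (P \x prod_prob P n')%E (@tuple_cons n')
  end.

Lemma prod_prob_rect (P : probability T R) n (A : 'I_n -> set T) :
  (forall i, measurable (A i)) ->
  prod_prob P n [set t | forall i, A i (tnth t i)] = (\prod_(i < n) P (A i))%E.
Proof.
elim: n A => [|n IH] A mA.
  rewrite big_ord0 /= diracE mem_set//= => -[].
  by case.
have mR : measurable [set t : n.-tuple T | forall i, A (lift ord0 i) (tnth t i)].
  rewrite [X in measurable X](_ : _ = \bigcap_(i in [set: 'I_n])
      ((@tnth _ T ^~ i) @^-1` A (lift ord0 i))); last first.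
    by apply/seteqP; split => [t At i _|t At i]; [exact: At|exact: At].
  apply: fin_bigcap_measurable => // i _.
  by rewrite -[X in measurable X]setTI; exact: measurable_tnth.
rewrite big_ord_recl -IH//= /distribution /pushforward.
rewrite -product_measure1E//; congr (_ _).
apply/seteqP; split => [[x t]/= At|[x t]/= [A0x At] i].
  split; first by have := At ord0.
  by move=> i; have := At (lift ord0 i); rewrite tnthS.
by case: (unliftP ord0 i) => [j ->|->//]; rewrite tnthS.
Qed.

End product_probability.

(* The support of P: the points all of whose open neighbourhoods have positive
   measure. *)
Definition measure_support {T : topologicalType} {A : set T} {A0 : A !=set0}
    {R : realType} (P : probability (borel_subspace A0) R) :
    set (borel_subspace A0) :=
  [set x | forall U, open U -> U x -> (0 < P U)%E].

Section programs.
Context {R : realType} {n : nat} {disp : measure_display}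
  {S : measurableType disp}.
Variables (c : 'cV[R]_n) (X : set 'cV[R]_n) (f : 'cV[R]_n -> S -> R).

Definition objective (x : 'cV[R]_n) : R := (c^T *m x) 0 0.

(* The least element of B (0 if there is none). *)
Definition minimum (B : set R) : R := xget 0 (B `&` lbound B).

Definition robust_value : R :=
  inf [set objective x | x in [set x | X x /\ forall s, f x s <= 0]].

Definition scenario_value N (w : N.-tuple S) : R :=
  minimum [set objective x |
    x in [set x | X x /\ forall i : 'I_N, f x (tnth w i) <= 0]].

Definition scenario_sup N : R := sup (range (@scenario_value N)).

Definition tail_prob (P : probability S R) N (alpha : R) : \bar R :=
  prod_prob P N [set w | scenario_sup N - alpha <= scenario_value w].

(* The supremum is taken in [0, +oo[: on the empty set, sup is 0. *)
Definition alpha_star (P : probability S R) N (eps : R) : R :=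
  sup [set alpha | 0 <= alpha /\ (tail_prob P N alpha <= eps%:E)%E].

End programs.

(* Main.v *)
(* Helly's theorem and compactness give J* <= sup g_N: if every g_N(omega) were at
   most some r < J*, then {x in X : c^T x <= r} would meet any d of the convex
   sets {x in X : f(x, delta) <= 0}; as these also have a common point, Helly's
   theorem in dimension d applies to all of them together and yields a robustly
   feasible point of objective at most r.  It remains to see that
   p_N(a) >= eps for a = alpha_star, which is continuity of P^N from above along
   a + 1/(k+1); this requires {omega : s <= g_N(omega)} to be measurable.
   By the tube lemma {omega : s < g_N(omega)} is open in Delta^N, and second
   countability turns an open set into a countable union of measurable boxes. *)

Require Import Defs.
From HB Require Import structures.
From mathcomp Require Import all_boot all_order all_algebra finmap.
From mathcomp Require Import all_classical all_reals all_analysis.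
From mathcomp Require Import ring.

Set Implicit Arguments.
Unset Strict Implicit.
Unset Printing Implicit Defensive.

Import Order.TTheory GRing.Theory Num.Theory.
Import numFieldNormedType.Exports.

Local Open Scope classical_set_scope.
Local Open Scope ring_scope.

(** * Convex combinations, Radon's theorem and Helly's theorem *)

Lemma convex_set_weighted_sum (R : realFieldType) (V : lmodType R) (A : set V)
    (I : Type) (r : seq I) (p : pred I) (a : I -> R) (x : I -> V) :
  convex_set A -> (forall i, p i -> 0 < a i) -> (forall i, p i -> A (x i)) ->
  0 < \sum_(i <- r | p i) a i ->
  A ((\sum_(i <- r | p i) a i)^-1 *: \sum_(i <- r | p i) a i *: x i).
Proof.
move=> cA a0 Ax.
(* Invariant of a partial sum with total weight [s] and vector [y]. The first case covers the empty
   sum; two parts of positive weight are merged by the convex combination of their normalised points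
   with coefficient [s / (s + t)]. *)
pose K (s : R) (y : V) := s = 0 /\ y = 0 \/ 0 < s /\ A (s^-1 *: y).
suff: K (\sum_(i <- r | p i) a i) (\sum_(i <- r | p i) a i *: x i).
  by case=> [[-> _]|[_ //]]; rewrite ltxx.
apply: (big_ind2 K) => [|s y t z|i pi]; first by left.
  case=> [[-> ->]|[s0 Asy]]; first by rewrite !add0r.
  case=> [[-> ->]|[t0 Atz]]; first by rewrite !addr0; right.
  right; have st0 : 0 < s + t by exact: addr_gt0.
  split=> //.
  have l0 : 0 <= s / (s + t) by rewrite divr_ge0 ?ltW.
  have l1 : s / (s + t) <= 1 by rewrite ler_pdivrMr// mul1r lerDl ltW.
  have := cA _ _ (Itv01 l0 l1) (mem_set Asy) (mem_set Atz).
  rewrite inE; congr A.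
  rewrite /conv/= !scalerA scalerDr; congr (_ *: _ + _ *: _).
    by rewrite mulrAC mulfV ?mul1r ?gt_eqF.
  rewrite [X in X / t](_ : _ = 1 - s / (s + t))//.
  by field; rewrite ?gt_eqF.
right; split; first exact: a0.
by rewrite scalerA mulVf ?scale1r; [exact: Ax|rewrite gt_eqF ?a0].
Qed.

(** Appending a coordinate 1 to each point gives [n] vectors in dimension [d + 1 < n], hence a
    linear relation; its last coordinate says that the coefficients sum to 0. *)
Lemma affine_dependence (F : fieldType) (d n : nat) (x : 'I_n -> 'cV[F]_d) :
  (d.+1 < n)%N ->
  exists u : 'I_n -> F, [/\ exists k, u k != 0,
    \sum_k u k = 0 & \sum_k u k *: x k = 0].
Proof.
move=> dn.
pose M : 'M[F]_(n, d + 1) :=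
  row_mx (\matrix_(k, j) x k j 0) (const_mx 1).
have : kermx M != 0.
  rewrite -mxrank_eq0 mxrank_ker subn_eq0 -ltnNge.
  by rewrite (leq_ltn_trans (rank_leq_col M))// addn1.
case/rowV0Pn => v /sub_kermxP; rewrite mul_mx_row => vM v0.
have [v1 v2] : v *m (\matrix_(k, j) x k j 0) = 0 /\
               v *m (const_mx 1 : 'cV_n) = 0.
  by apply: eq_row_mx; rewrite vM row_mx0.
exists (fun k => v 0 k); split.
- by have /rV0Pn[k vk] := v0; exists k.
- move/matrixP/(_ 0 0): v2; rewrite !mxE; apply: etrans.
  by apply: eq_bigr => k _; rewrite mxE mulr1.
- apply/colP => j; move/rowP/(_ j): v1; rewrite !mxE summxE.
  by apply: etrans; apply: eq_bigr => k _; rewrite !mxE.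
Qed.

(* The pair (p, ~~ p) is the Radon partition and y the common point of the two
   convex hulls. *)
Lemma radon (R : realFieldType) (d n : nat) (x : 'I_n -> 'cV[R]_d) :
  (d.+1 < n)%N ->
  exists (y : 'cV[R]_d) (p : pred 'I_n), forall A : set 'cV[R]_d,
    convex_set A ->
    (forall k, p k -> A (x k)) \/ (forall k, ~~ p k -> A (x k)) -> A y.
Proof.
move=> /(affine_dependence x)[u [[k0 uk0] su sux]].
(* The dependence is split by sign: the two halves have the same total weight and the same weighted
   sum, hence the same normalised point. *)
pose sp := \sum_(k | 0 < u k) u k; pose sn := \sum_(k | u k < 0) - u k.
have splitu (V : zmodType) (g : 'I_n -> V) : (forall k, u k = 0 -> g k = 0) ->
    \sum_k g k = \sum_(k | 0 < u k) g k - \sum_(k | u k < 0) - g k.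
  move=> g0; rewrite (bigID (fun k => 0 < u k))/=; congr (_ + _).
  rewrite -sumrN (bigID (fun k => u k < 0))/= [X in _ + X]big1 ?addr0.
    apply: eq_big => k; last by rewrite opprK.
    by rewrite andbC; case: ltgtP.
  by move=> k /andP[]; rewrite -!leNgt => ? ?; apply/g0/le_anti/andP.
have spn : sp = sn by apply/eqP; rewrite -subr_eq0 -splitu// su.
have vpn : \sum_(k | 0 < u k) u k *: x k = \sum_(k | u k < 0) - u k *: x k.
  under [RHS]eq_bigr do rewrite scaleNr.
  by apply/eqP; rewrite -subr_eq0 -splitu ?sux// => k ->; rewrite scale0r.
have sp0 : 0 < sp.
  have sp_ge0 : 0 <= sp by apply: sumr_ge0 => k /ltW.
  rewrite lt_def sp_ge0 andbT; apply: contra uk0 => /eqP sp0.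
  have [uk|uk|//] := ltgtP (u k0) 0.
    have sn0 : sn = 0 by rewrite -spn.
    have nu k : u k < 0 -> 0 <= - u k by rewrite oppr_ge0 => /ltW.
    have /eqP := psumr_eq0P nu sn0 uk.
    by rewrite oppr_eq0 lt_eqF.
  have pu k : 0 < u k -> 0 <= u k by exact: ltW.
  by have /eqP := psumr_eq0P pu sp0 uk; rewrite gt_eqF.
exists (sp^-1 *: \sum_(k | 0 < u k) u k *: x k), (fun k => 0 < u k) => A cA.
case=> Ax; first exact: convex_set_weighted_sum.
rewrite vpn spn; apply: convex_set_weighted_sum => //.
- by move=> k; rewrite oppr_gt0.
- by move=> k uk; apply: Ax; rewrite -leNgt ltW.
- by rewrite -/sn -spn.
Qed.

(** Induction on [#|J|]: when [J] has more than [d + 1] members, dropping each in turn leaves a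
    family with a common point, and Radon's theorem applies to the points so obtained. *)
Lemma helly (R : realFieldType) (d : nat) (I : finType)
    (F : I -> set 'cV[R]_d) (J : {set I}) :
  (forall i, convex_set (F i)) ->
  (forall K : {set I}, K \subset J -> (#|K| <= d.+1)%N ->
    exists y, forall i, i \in K -> F i y) ->
  exists y, forall i, i \in J -> F i y.
Proof.
move=> cF; have [n] := ubnP #|J|; elim: n J => // n IH J Jn small.
have [Jd|dJ] := leqP #|J| d.+1; first exact: small.
have /choice[x Fx] (k : 'I_#|J|) :
    exists y, forall i, i \in J :\ enum_val k -> F i y.
  apply: IH => [|K KJ]; last first.
    by apply: small; exact: fintype.subset_trans KJ (subD1set _ _).
  rewrite -ltnS (leq_trans _ Jn)// ltnS.
  by rewrite [leqRHS](cardsD1 (enum_val k)) enum_valP.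
have [y [p Fy]] := radon x dJ.
exists y => i iJ; apply: Fy => //.
have [/= ki kiE] : exists k : 'I_#|J|, enum_val k = i.
  by exists (enum_rank_in iJ i); rewrite enum_rankK_in.
have Fki k : k != ki -> F i (x k).
  move=> kki; apply: Fx; rewrite !inE iJ andbT -kiE.
  by apply: contra kki => /eqP/enum_val_inj ->.
(* Only [x ki] may lie outside [F i], so the side of the partition that misses [ki] lies entirely in
   [F i]. *)
case pki: (p ki); [right|left] => k pk; apply: Fki.
  by apply: contraNneq pk => ->; rewrite pki.
by apply: contraTneq pk => ->; rewrite pki.
Qed.

(** * Rational balls and measurability of open sets of tuples *)

Lemma rational_ball_basis (R : realType) (m n : nat) (x : 'M[R]_(m, n))
    (U : set 'M[R]_(m, n)) : nbhs x U ->
  exists q : 'M[rat]_(m, n) * nat,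
    let B := ball (map_mx ratr q.1 : 'M[R]_(m, n)) q.2.+1%:R^-1 in
    B x /\ B `<=` U.
Proof.
move=> /nbhs_ballP[e /= e0 xeU].
have e20 : 0 < e / 2 by rewrite divr_gt0.
have [k ke] : exists k, k.+1%:R^-1 < e / 2 :> R.
  have [k _ /(_ _ (leqnn k)) ke] := near_infty_natSinv_lt (PosNum e20).
  by exists k.
have k0 : 0 < k.+1%:R^-1 :> R by rewrite invr_gt0.
have /choice[q qx] (ij : 'I_m * 'I_n) : exists q : rat,
    `|ratr q - x ij.1 ij.2| < k.+1%:R^-1.
  have [|q] := @rat_in_itvoo R (x ij.1 ij.2 - k.+1%:R^-1)
    (x ij.1 ij.2 + k.+1%:R^-1).
    by rewrite ltrD2l gtrN.
  by rewrite in_itv/= => qx; exists q; rewrite ltr_distl.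
(* The radius is below [e / 2] and the centre is within that radius of [x], so every point of the
   ball is within [e] of [x]. *)
exists (\matrix_(i, j) q (i, j), k) => /=.
have Bx : ball (map_mx ratr (\matrix_(i, j) q (i, j)) : 'M[R]_(m, n))
    k.+1%:R^-1 x.
  by split=> // i j; rewrite !mxE; exact: qx (i, j).
split=> // y By; apply: xeU; rewrite [e]splitr.
by apply: ball_triangle (le_ball (ltW ke) _) (le_ball (ltW ke) By);
  exact: ball_sym.
Qed.

Lemma measurable_tuple_box d (T : measurableType d) N (U : 'I_N -> set T) :
  (forall i, measurable (U i)) ->
  measurable [set w : N.-tuple T | forall i, U i (tnth w i)].
Proof.
move=> mU; rewrite [X in measurable X](_ : _ =
    \bigcap_(i in [set: 'I_N]) ((@tnth _ T ^~ i) @^-1` U i)); last first.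
  by apply/seteqP; split => [t Ut i _|t Ut i]; [exact: Ut|exact: Ut].
apply: fin_bigcap_measurable => // i _.
by rewrite -[X in measurable X]setTI; exact: measurable_tnth.
Qed.

(** The hypothesis is openness of [G] in the product topology, expressed through boxes. Such a [G]
    is the union of the boxes of rational balls that it contains, and these are countably many. *)
Lemma measurable_open_tuple (R : realType) (m n N : nat)
    (A : set 'M[R]_(m, n)) (A0 : A !=set0)
    (G : set (N.-tuple (borel_subspace A0))) :
  (forall w, G w -> exists2 V : 'I_N -> set (borel_subspace A0),
    forall i, nbhs (tnth w i) (V i) &
    [set v : N.-tuple _ | forall i, V i (tnth v i)] `<=` G) ->
  measurable G.
Proof.
move=> oG.
pose b (q : 'M[rat]_(m, n) * nat) : set (borel_subspace A0) :=
  set_val @^-1` (ball (map_mx ratr q.1 : 'M[R]_(m, n)) q.2.+1%:R^-1).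
have bopen q : open (b q).
  exists (ball (map_mx ratr q.1 : 'M[R]_(m, n)) q.2.+1%:R^-1) => //.
  exact: ball_open.
pose D := [set q : {ffun 'I_N -> 'M[rat]_(m, n) * nat} |
  [set v : N.-tuple _ | forall i, b (q i) (tnth v i)] `<=` G].
have -> : G = \bigcup_(q in D)
    [set v : N.-tuple _ | forall i, b (q i) (tnth v i)].
  apply/seteqP; split=> [w Gw|w [q Dq]]; last exact: Dq.
  have [V Vw VG] := oG w Gw.
  have /choice[q qV] i : exists q, b q (tnth w i) /\ b q `<=` V i.
    have := Vw i; rewrite nbhsE => -[_ [[W oW <-] Ww] WV].
    have [|q [qw qW]] := @rational_ball_basis R m n (set_val (tnth w i)) W.
      exact: open_nbhs_nbhs.
    by exists q; split=> // v /qW; exact: WV.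
  exists (finfun q); rewrite /D/=.
    by move=> v vb; apply: VG => i; have := vb i;
      rewrite ffunE; exact: (qV i).2.
  by move=> i; rewrite ffunE; exact: (qV i).1.
rewrite bigcup_mkcond; apply: countable_bigcupT_measurable.
  exact: countableP.
move=> q; case: ifPn => // _.
apply: (measurable_tuple_box (U := fun i => b (q i))) => i.
exact: sub_sigma_algebra.
Qed.

(** * Continuity of the objective; Helly's theorem for infinite families *)

Lemma objective_continuous (R : realType) d (c : 'cV[R]_d) :
  continuous (objective c).
Proof.
have -> : objective c = fun x => \sum_i c i 0 * x i 0.
  apply/funext => x; rewrite /objective mxE.
  by apply: eq_bigr => i _; rewrite mxE.
apply: (@continuous_big _ _ +%R 0 xpredT _ _ _
  (fun i (x : 'cV[R]_d) => c i 0 * x i 0)) => [|i _ x].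
  exact: (@add_continuous R^o).
apply: cvgMr; first exact: nbhs_filter.
exact: (@coord_continuous R d 1 i 0).
Qed.

(** Helly's theorem handles finite subfamilies, compactness of [A] the whole family. Lists of size
    [d] suffice because [A] itself takes one of the [d + 1] places. *)
Lemma helly_compact (R : realType) (d : nat) (I : choiceType)
    (A : set 'cV[R]_d) (F : I -> set 'cV[R]_d) :
  compact A -> convex_set A ->
  (forall i, closed (F i)) -> (forall i, convex_set (F i)) ->
  (exists x, forall i, F i x) ->
  (forall r : seq I, (size r <= d)%N ->
    exists2 x, A x & forall i, i \in r -> F i x) ->
  exists2 x, A x & forall i, F i x.
Proof.
move=> kA cA clF cF [x0 Fx0] small.
have fin (D : {fset I}) : exists2 x, A x & forall i, i \in D -> F i x.
  pose G (o : option D) := if o is Some i then F (val i) else A.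
  have [|K _ Kd|y Gy] := helly (F := G) (J := [set: option D]%SET).
  - by case=> [i|] //=; exact: cF.
  (* [None] stands for [A]; a subfamily without it has the common point [x0]. *)
  - have [NK|NK] := boolP (None \in K); last first.
      by exists x0 => -[i|/(negP NK)//] _; exact: Fx0.
    pose r := pmap (omap (@fsval _ D)) (enum (K :\ None)).
    have [|y Ay Fy] := small r.
      rewrite -ltnS (leq_trans _ Kd)// (cardsD1 None) NK add1n ltnS.
      by rewrite size_pmap (leq_trans (count_size _ _))// -cardE.
    exists y => -[i|] //= iK; apply: Fy.
    rewrite mem_pmap; apply/mapP.
    by exists (Some i); rewrite // mem_enum !inE.
  exists y; first by have := Gy None; rewrite inE; exact.
  by move=> i iD; have := Gy (Some [` iD]%fset); rewrite inE; exact.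
have := kA; rewrite compact_In0.
move=> /(_ I setT (fun i => A `&` F i))[|D _|x Ax].
- by exists F.
- by have [x Ax Fx] := fin D; exists x => i /= iD; split=> //; exact: Fx.
(* For empty [I] the intersection gives no membership in [A]; the point then comes from the empty
   list. *)
- have [[i0]|I0] := pselect (inhabited I).
    by exists x => [|i]; [have [] := Ax i0 Logic.I|have [] := Ax i Logic.I].
  have [//|y Ay _] := small [::].
  by exists y => // i; case: I0; exists.
Qed.

(** * Scenario values and their comparison with the robust value *)

Section programs_theory.
Context {R : realType} {d : nat} {disp : measure_display}
  {S : measurableType disp}.
Variables (c : 'cV[R]_d) (X : set 'cV[R]_d) (f : 'cV[R]_d -> S -> R).
Variable x0 : 'cV[R]_d.
Hypothesis kX : compact X.
Hypothesis Xx0 : X x0.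
Hypothesis fx0 : forall s, f x0 s <= 0.
Hypothesis closed_constraint : forall s, closed [set x | X x /\ f x s <= 0].

Lemma within_objective_continuous (A : set 'cV[R]_d) :
  {within A, continuous (objective c)}.
Proof. exact/continuous_subspaceT/objective_continuous. Qed.

Lemma objective_lower_bound : exists b, forall x, X x -> b <= objective c x.
Proof.
have [|y _ ymin] := compact_EVT_min _ kX (@within_objective_continuous X).
  by exists x0.
by exists (objective c y) => x Xx; apply: ymin; rewrite inE.
Qed.

(** The feasible set is compact and contains [x0], so the minimum is attained and the default value
    in [minimum] never occurs. *)
Lemma scenario_valueP N (w : N.-tuple S) : exists x,
  [/\ X x, forall i, f x (tnth w i) <= 0, scenario_value c X f w = objective c x
    & forall y, X y -> (forall i, f y (tnth w i) <= 0) ->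
        objective c x <= objective c y].
Proof.
pose A := [set x | X x /\ forall i : 'I_N, f x (tnth w i) <= 0].
have kA : compact A.
  have -> : A = X `&` \bigcap_i [set x | X x /\ f x (tnth w i) <= 0].
    apply/seteqP; split=> [x [Xx fx]|x [Xx fx]]; split=> // i.
    by have [] := fx i Logic.I.
  by apply: compact_closedI => //; apply: closed_bigI => i _.
have [|x xA xmin] := compact_EVT_min _ kA (@within_objective_continuous A).
  by exists x0; split.
have [Xx fx] : A x by rewrite inE in xA.
have {}xmin y : X y -> (forall i, f y (tnth w i) <= 0) ->
    objective c x <= objective c y.
  by move=> Xy fy; apply: xmin; rewrite inE.
exists x; split=> //; apply: xget_unique.
  split; first by exists x.
  by move=> _ [y [Xy fy] <-]; exact: xmin.
move=> z [[y [Xy fy] <-] ymin]; apply/le_anti; rewrite xmin// andbT.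
by apply: ymin; exists x.
Qed.

Lemma scenario_value_leP N (w : N.-tuple S) r :
  scenario_value c X f w <= r <->
  exists x, [/\ X x, forall i, f x (tnth w i) <= 0 & objective c x <= r].
Proof.
have [x [Xx fx -> xmin]] := scenario_valueP w; split; first by exists x.
by move=> [y [Xy fy]]; apply: le_trans; exact: xmin.
Qed.

(** This uniform bound makes [scenario_sup] a genuine supremum. *)
Lemma scenario_value_ub N (w : N.-tuple S) :
  scenario_value c X f w <= objective c x0.
Proof. by apply/scenario_value_leP; exists x0. Qed.

Lemma scenario_value_sup N (w : N.-tuple S) :
  scenario_value c X f w <= scenario_sup c X f N.
Proof.
apply: ub_le_sup; last by exists w.
by exists (objective c x0) => _ [v _ <-]; exact: scenario_value_ub.
Qed.

Lemma robust_value_le_scenario_sup N :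
  convex_set X -> (forall s, convex_function X (fun x => f x s)) ->
  (d <= N)%N ->
  robust_value c X f <= scenario_sup c X f N.
Proof.
move=> cX cf dN; pose r := scenario_sup c X f N.
pose A := X `&` objective c @^-1` [set y | y <= r].
have [| | | | |s|y [Xy yr] fy] := helly_compact (A := A)
    (F := fun s : S => [set x | X x /\ f x s <= 0]).
- apply: compact_closedI => //; apply: closed_comp; last exact: closed_le.
  by move=> x _; exact: objective_continuous.
- move=> x y t; rewrite !inE => -[Xx xr] [Xy yr]; split.
    by have := cX x y t; rewrite !inE; exact.
  rewrite /= [leLHS](_ : _ =
      t%:num * objective c x + (1 - t%:num) * objective c y);
    last by rewrite /objective mulmxDr -!scalemxAr !mxE.
  rewrite [leRHS](_ : r = t%:num * r + (1 - t%:num) * r); last by ring.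
  have t1 : 0 <= 1 - t%:num by rewrite subr_ge0 le1.
  by apply: lerD; exact: ler_wpM2l.
- exact: closed_constraint.
- move=> s x y t; rewrite !inE => -[Xx xs] [Xy ys]; split.
    by have := cX x y t; rewrite !inE; exact.
  apply: le_trans (cf s t x y (mem_set Xx) (mem_set Xy)) _.
  rewrite convRE; have -> : 0 = t%:num * 0 + (1 - t%:num) * 0 :> R by ring.
  have t1 : 0 <= 1 - t%:num by rewrite subr_ge0 le1.
  by apply: lerD; exact: ler_wpM2l.
- by exists x0 => s.
(* A list of at most [d <= N] scenarios is padded with [point] to an [N]-tuple, whose scenario value
   is at most [r]. *)
- move=> sr; pose w := [tuple nth point s i | i < N].
  have [x [Xx xw xr]] :=
    (scenario_value_leP w r).1 (scenario_value_sup w).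
  exists x => // t ts; split=> //.
  have tN : (index t s < N)%N.
    by rewrite (leq_trans _ dN)// (leq_trans _ sr)// index_mem.
  by have := xw (Ordinal tN); rewrite tnth_mktuple/= nth_index.
apply: le_trans yr; apply: ge_inf; last first.
  by exists y => //; split=> // s; have [] := fy s.
have [b bX] := objective_lower_bound.
by exists b => _ [x [Xx _] <-]; exact: bX.
Qed.

End programs_theory.

(** * Measurability of scenario values and the tail probability *)

Section scenario_measurability.
Context {R : realType} {d m : nat} {Delta : set 'cV[R]_m}
  {Delta0 : Delta !=set0}.
Variables (c : 'cV[R]_d) (X : set 'cV[R]_d)
  (f : 'cV[R]_d -> borel_subspace Delta0 -> R) (x0 : 'cV[R]_d).
Hypothesis kX : compact X.
Hypothesis lsc_f : lower_semicontinuous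
  ((fun z => (f z.1 z.2)%:E) :
    subspace (X `*` [set: borel_subspace Delta0]) -> \bar R).
Hypothesis Xx0 : X x0.
Hypothesis fx0 : forall s, f x0 s <= 0.

(** Lower semicontinuity holds relative to the subspace; the premise [X y] turns the relative
    neighbourhood into one in the whole space. *)
Lemma near_constraint_violated x s : X x -> 0 < f x s ->
  \forall y \near x & t \near s, X y -> 0 < f y t.
Proof.
move=> Xx fxs; have := lsc_f (x := (x, s)) (a := 0); rewrite /= lte_fin.
move=> /(_ fxs)[W]; rewrite /nbhs/= -nbhs_subspace_in; last by split.
move=> [[U V] [Ux Vs] UVW] WV; exists (U, V) => //= -[y t] [/= Uy Vt] Xy.
by rewrite -lte_fin; apply: (WV (y, t)); exact: (UVW (y, t)).
Qed.

Lemma closed_constraint s : closed [set x | X x /\ f x s <= 0].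
Proof.
move=> x clx; have Xx : X x.
  apply: (compact_closed (@norm_hausdorff _ _) kX) => U /clx[y [[Xy _] Uy]].
  by exists y.
split=> //; rewrite leNgt; apply/negP => /(near_constraint_violated Xx).
move=> [[U V] [/= Ux Vs] UV]; have [y [[Xy fy] Uy]] := clx U Ux.
have := UV (y, s) (conj Uy (nbhs_singleton Vs)) Xy.
by rewrite /= ltNge fy.
Qed.

Let value_leP := scenario_value_leP c kX Xx0 fx0 closed_constraint.

Lemma measurable_scenario_value_gt N r :
  measurable [set w : N.-tuple _ | r < scenario_value c X f w].
Proof.
apply: measurable_open_tuple => w /= rw.
(* The neighbourhood filter of [w] in the product topology, generated by boxes. *)
pose Fw := filter_from
  [set V : 'I_N -> set (borel_subspace Delta0) |
    forall i, nbhs (tnth w i) (V i)]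
  (fun V => [set v : N.-tuple _ | forall i, V i (tnth v i)]).
have FF : Filter Fw.
  apply: filter_from_filter => [|V W Vw Ww].
    by exists (fun=> setT) => i; exact: filterT.
  exists (fun i => V i `&` W i) => [i|v VWv]; first exact: filterI.
  by split=> i; have [] := VWv i.
have kA : compact (X `&` objective c @^-1` [set y | y <= r]).
  apply: compact_closedI => //; apply: closed_comp; last exact: closed_le.
  by move=> x _; exact: objective_continuous.
(* Tube lemma, as the near-covering form of compactness: each point of objective at most [r]
   violates a constraint sampled in [w], and this persists nearby, so one box around [w] serves all
   these points. *)
have [x [Xx xr]|V Vw VX] := (compact_near_coveringP _).1 kA _ Fw
    (fun v x => X x -> exists i, 0 < f x (tnth v i)) FF.
  have [i fxi] : exists i, 0 < f x (tnth w i).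
    apply/not_existsP => fx; move: rw; rewrite ltNge => /negP; apply.
    apply/value_leP; exists x; split=> // i.
    by rewrite leNgt; apply/negP; exact: fx.
  have [[U V] [/= Ux Vi] UV] := near_constraint_violated Xx fxi.
  exists (U, [set v | V (tnth v i)]).
    split=> //=; exists (fun j => if j == i then V else setT).
      by move=> j; case: eqP => [->|_] //; exact: filterT.
    by move=> v /= /(_ i); rewrite eqxx.
  by move=> [y v] [/= Uy Vv] Xy; exists i; exact: (UV (y, tnth v i)).
exists V => // v Vv; rewrite /= ltNge; apply/negP => /value_leP[x [Xx fx xr]].
have [] := VX v Vv x => // i; by rewrite ltNge fx.
Qed.

Lemma measurable_scenario_value_ge N r :
  measurable [set w : N.-tuple _ | r <= scenario_value c X f w].
Proof.
rewrite [X in measurable X](_ : _ =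
    \bigcap_n [set w | r - n.+1%:R^-1 < scenario_value c X f w]).
  by apply: bigcap_measurable => // n _; exact: measurable_scenario_value_gt.
apply/seteqP; split=> [w /= rw n _|w rw] /=.
  by rewrite (lt_le_trans _ rw)// gtrBl invr_gt0.
apply/ler_addgt0Pr => e e0; rewrite -lerBlDr.
have [k _ /(_ _ (leqnn k)) ke] := near_infty_natSinv_lt (PosNum e0).
by rewrite (le_trans _ (ltW (rw k Logic.I)))// lerB// ltW.
Qed.

Lemma tail_prob_alpha_star (P : probability (borel_subspace Delta0) R) N eps :
  eps < 1 ->
  (eps%:E <= tail_prob c X f P N (alpha_star c X f P N eps))%E.
Proof.
move=> eps1; set a := alpha_star c X f P N eps.
pose E := [set alpha | 0 <= alpha /\ (tail_prob c X f P N alpha <= eps%:E)%E].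
have aE : a = sup E by [].
have [b bX] := objective_lower_bound c kX Xx0.
(* Beyond this bound the tail event is the whole space, of probability [1 > eps]. *)
have ubE : ubound E (scenario_sup c X f N - b).
  move=> alpha [_ pe]; rewrite leNgt; apply/negP => alphab.
  move: pe; rewrite /tail_prob (_ : [set _ | _] = setT); last first.
    apply/seteqP; split=> // w _ /=.
    have [x [Xx _ -> _]] := scenario_valueP c kX Xx0 fx0 closed_constraint w.
    apply: le_trans (bX x Xx).
    by rewrite lerBlDr -lerBlDl ltW.
  by rewrite probability_setT lee_fin leNgt eps1.
(* For empty [E] this rests on the convention that the supremum is 0. *)
have a0 : 0 <= a.
  rewrite aE; have [[y Ey]|/nonemptyPn E0] := pselect (E !=set0).
    by apply: le_trans Ey.1 _; apply: ub_le_sup => //;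
      exists (scenario_sup c X f N - b).
  by rewrite E0 sup0.
pose F k := [set w : N.-tuple _ |
  scenario_sup c X f N - (a + k.+1%:R^-1) <= scenario_value c X f w].
have capF : \bigcap_k F k =
    [set w | scenario_sup c X f N - a <= scenario_value c X f w].
  apply/seteqP; split=> [w Fw|w aw k _] /=; last first.
    by apply: le_trans aw; rewrite lerB// lerDl.
  apply/ler_addgt0Pr => e e0.
  have [k _ /(_ _ (leqnn k)) ke] := near_infty_natSinv_lt (PosNum e0).
  have := Fw k Logic.I; rewrite /F/= opprD addrA lerBlDr => /le_trans; apply.
  by rewrite lerD2l ltW.
have cvgF : (prod_prob P N \o F) @ \oo --> prod_prob P N (\bigcap_k F k).
  apply: nonincreasing_cvg_mu.
  - rewrite (le_lt_trans (probability_le1 _ _)) ?ltry//.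
    exact: measurable_scenario_value_ge.
  - by move=> k; exact: measurable_scenario_value_ge.
  - by rewrite capF; exact: measurable_scenario_value_ge.
  - move=> k l kl; apply/subsetPset => w /=; apply: le_trans.
    by rewrite lerB// lerD2l lef_pV2 ?posrE// ler_nat.
rewrite /tail_prob -capF -(cvg_lim _ cvgF)//.
apply: lime_ge; first by apply/cvg_ex; exists (prod_prob P N (\bigcap_k F k)).
(* Since [a + 1/(k+1)] is nonnegative and exceeds [sup E], its tail probability cannot be below
   [eps]. *)
apply: nearW => k; rewrite leNgt; apply/negP => Fk.
have : E (a + k.+1%:R^-1) by split; [rewrite addr_ge0|exact: ltW].
move=> /(ub_le_sup (ex_intro _ _ ubE)); rewrite -aE leNgt => /negP; apply.
by rewrite ltrDl invr_gt0.
Qed.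

End scenario_measurability.

Theorem proposition1 (R : realType) (d m N : nat)
    (c : 'cV[R]_d) (X : set 'cV[R]_d)
    (Delta : set 'cV[R]_m) (Delta0 : Delta !=set0)
    (P : probability (borel_subspace Delta0) R)
    (f : 'cV[R]_d -> borel_subspace Delta0 -> R) (eps : R) :
  (1 <= d)%N ->
  measure_support P = setT ->
  compact X ->
  convex_set X ->
  lower_semicontinuous
    ((fun z => (f z.1 z.2)%:E) :
      subspace (X `*` [set: borel_subspace Delta0]) -> \bar R) ->
  (forall delta, convex_function X (fun x => f x delta)) ->
  (exists2 x, X x & forall delta, f x delta <= 0) ->
  (d <= N)%N ->
  0 < eps < 1 ->
  (eps%:E <= prod_prob P N
     [set w | (robust_value c X f <=
               scenario_value c X f w + alpha_star c X f P N eps)%R])%E.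
Proof.
move=> _ _ kX cX lscf cf [x0 Xx0 fx0] dN /andP[_ eps1].
have robust_le := robust_value_le_scenario_sup c kX Xx0 fx0
  (closed_constraint kX lscf) cX cf dN.
(* By [robust_le], the tail event at [alpha_star] is contained in the event of the statement. *)
apply: le_trans (tail_prob_alpha_star c kX lscf Xx0 fx0 P N eps1) _.
apply: le_measure; rewrite ?inE.
- exact: measurable_scenario_value_ge kX lscf Xx0 fx0 _ _.
- under eq_set do rewrite -lerBlDr.
  exact: measurable_scenario_value_ge kX lscf Xx0 fx0 _ _.
- by move=> w /=; rewrite lerBlDr; exact: le_trans.
Qed.
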